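(* Let $\Delta=(Q,\Gamma,\delta)$ be a probabilistic pushdown automaton (pPDA) with cleaned-up fundamental PPS $g$, and suppose that $\Delta$ is cPAST. Let $C = \max_{p,Z,q} \frac{\mathsf{E}[pZ|q]}{[pZ|q]} \ge 1$ be the maximal conditional expected runtime of $\Delta$, and let $m = \min_{p,Z,q} [pZ|q]$ be the minimum non-zero return probability (both taken over the $(p,Z,q)\in Q\times\Gamma\times Q$ with $[pZ|q]>0$). Then there exists a vector $v$, indexed by the index set of $g$, with $v_j>0$ for all $j$ and $\|v\|_1 = 1$, such that $$g'(\mu g)\, v \le (1 - C^{-1})\, v \quad\text{and}\quad \min_j v_j \ge \frac{m}{C\,|Q|^2\,|\Gamma|}.$$ As a consequence, the spectral radius satisfies $\rho(g'(\mu g)) \le 1 - C^{-1}$.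
   Context: A pPDA $\Delta=(Q,\Gamma,\delta)$ has a finite state set $Q$, a finite stack alphabet $\Gamma$, and a weighted transition relation $\delta \subseteq Q\times\Gamma\times\mathbb{Q}_{\ge 0}\times Q\times\Gamma^{\le 2}$ ($\Gamma^{\le 2}$: words of length at most 2), where for each $(p,Z,q,\alpha)$ there is at most one $a$ with $(p,Z,a,q,\alpha)\in\delta$; such a transition is written $pZ \xrightarrow{a} q\alpha$. For all $pZ\in Q\times\Gamma$ one requires $\sum_{pZ\xrightarrow{a}q\alpha} a = 1$. Configurations are elements $p\gamma$ of $Q\times\Gamma^*$; each transition $pZ\xrightarrow{a}q\alpha$ and $\beta\in\Gamma^*$ yields a step $pZ\beta \to q\alpha\beta$ of probability $a$; configurations $p\varepsilon$ with empty stack have no outgoing steps. The probability of a finite path of configurations is the product of its step probabilities; its length is its number of steps. For $p,q\in Q$, $Z\in\Gamma$: the return probability $[pZ|q]$ is the sum of the probabilities of all finite paths from $pZ$ to $q\varepsilon$, and the 1st termination moment $\mathsf{E}[pZ|q]\in[0,\infty]$ is the sum, over all these paths, of probability times length. $\Delta$ is cPAST if $\mathsf{E}[pZ|q]/[pZ|q] < \infty$ whenever $[pZ|q]>0$. A positive polynomial system (PPS) $f=(f_j)_{j\in J}$ ($J$ finite) consists of polynomials with non-negative real coefficients in variables $(x_j)_{j\in J}$; as a monotone function on $[0,\infty]^J$ it has a least fixed point $\mu f$. $f'(u)$ is its Jacobi matrix evaluated at $u$. Vector inequalities are component-wise. The spectral radius $\rho(A)$ is the largest absolute value of an eigenvalue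 of $A$. The fundamental PPS $f$ of $\Delta$ is indexed by $Q\times\Gamma\times Q$ and given by $$f_{pZq}(x)=\sum_{pZ\xrightarrow{a}q\varepsilon}a+\sum_{pZ\xrightarrow{a}rY}a\,x_{rYq}+\sum_{pZ\xrightarrow{a}rYX}a\sum_{t\in Q}x_{rYt}\,x_{tXq}.$$ It is known that $(\mu f)_{pZq}=[pZ|q]$. The cleaned-up PPS $g$ is obtained from $f$ by deleting all components $j$ with $(\mu f)_j=0$ and substituting $0$ for the corresponding variables; then $(\mu g)_j=(\mu f)_j>0$ for all remaining $j$. *)

(* Defs.v *)
(* MathComp world, with multinomials and MathComp-Analysis. *)
From HB Require Import structures.
From mathcomp Require Import all_boot all_order all_algebra.
From mathcomp Require Import complex mpoly.
From mathcomp Require Import boolp classical_sets reals ereal esum.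

Set Implicit Arguments.
Unset Strict Implicit.
Unset Printing Implicit Defensive.
Import Order.TTheory GRing.Theory Num.Theory.
Local Open Scope classical_set_scope.
Local Open Scope ring_scope.

(* The relation delta is encoded as a partial function: at most one weight a
   is attached to (p, Z, q, alpha), and [None] means that there is no such
   transition (a transition of weight 0 is allowed). *)
Record pPDA (Q G : finType) := PPDA {
  trans :> Q -> G -> Q -> 2.-bseq G -> option rat;
  trans_ge0 : forall p Z q alpha a, trans p Z q alpha = Some a -> 0 <= a;
  trans_sum1 : forall p Z,
    \sum_(q : Q) \sum_(alpha : 2.-bseq G) odflt 0 (trans p Z q alpha) = 1 }.

Section Runs.
Context (Q G : finType) (D : pPDA Q G).

Definition config : Type := (Q * seq G)%type.

Definition weight p Z q alpha : rat := odflt 0 (D p Z q alpha).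

Definition step (c c' : config) : bool :=
  if c.2 is Z :: beta then
    [exists alpha : 2.-bseq G,
      (D c.1 Z c'.1 alpha != None) && (c'.2 == alpha ++ beta)]
  else false.

(* At most one alpha satisfies the side condition. *)
Definition step_prob (c c' : config) : rat :=
  if c.2 is Z :: beta then
    \sum_(alpha : 2.-bseq G | c'.2 == alpha ++ beta) weight c.1 Z c'.1 alpha
  else 0.

(* A finite path is given by its first configuration c and the sequence s of
   the configurations after c, so that its length is [size s]. *)
Fixpoint path_prob (c : config) (s : seq config) : rat :=
  if s is c' :: s' then step_prob c c' * path_prob c' s' else 1.

Definition start (j : Q * G * Q) : config := (j.1.1, [:: j.1.2]).

Definition runs (j : Q * G * Q) : set (seq config) :=
  [set s | path step (start j) s /\ last (start j) s = (j.2, [::])].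

Variable R : realType.

Definition ret (j : Q * G * Q) : \bar R :=
  (\esum_(s in runs j) (ratr (path_prob (start j) s))%:E)%E.

Definition moment (j : Q * G * Q) : \bar R :=
  (\esum_(s in runs j) (ratr (path_prob (start j) s) * (size s)%:R)%:E)%E.

Definition cond_runtime (j : Q * G * Q) : \bar R := (moment j / ret j)%E.

Definition cPAST : Prop :=
  forall j, (0 < ret j)%E -> (cond_runtime j < +oo)%E.

Definition max_runtime : R :=
  fine (\big[Order.max/-oo%E]_(j : Q * G * Q | (0 < ret j)%E) cond_runtime j).

Definition min_ret : R :=
  fine (\big[Order.min/+oo%E]_(j : Q * G * Q | (0 < ret j)%E) ret j).

End Runs.

Section PolynomialSystems.
Variable R : realType.

(* The variable x_j, for j in a finite type J, is the variable of index
   [enum_rank j]. *)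
Definition polysys (J : finType) : Type := J -> {mpoly R[#|J|]}.

Definition pvar (J : finType) (j : J) : {mpoly R[#|J|]} := 'X_(enum_rank j).

Definition is_PPS (J : finType) (f : polysys J) : Prop :=
  forall j m, 0 <= (f j)@_m.

(* Evaluation in extended reals, where 0 * +oo = 0 and x ^+ 0 = 1. *)
Definition eeval (n : nat) (u : 'I_n -> \bar R) (p : {mpoly R[n]}) : \bar R :=
  (\sum_(m <- msupp p) (p@_m)%:E * \prod_(i < n) u i ^+ m i)%E.

Definition is_fixpoint (J : finType) (f : polysys J) (u : J -> \bar R) : Prop :=
  (forall j, 0 <= u j)%E /\ forall j, eeval (u \o enum_val) (f j) = u j.

Definition is_lfp (J : finType) (f : polysys J) (u : J -> \bar R) : Prop :=
  is_fixpoint f u /\ forall w, is_fixpoint f w -> forall j, (u j <= w j)%E.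

(* The least fixed point in [0, +oo]^J; the default value is irrelevant for a
   PPS, which always has a least fixed point. *)
Definition lfp (J : finType) (f : polysys J) : J -> \bar R :=
  xget (fun=> 0%E) [set u | is_lfp f u].

Definition jacobi (J : finType) (f : polysys J) (u : J -> R) : 'M[R]_#|J| :=
  \matrix_(i, k) ((f (enum_val i))^`M(k)).@[u \o enum_val].

Definition cleaned_idx (J : finType) (f : polysys J) : finType :=
  {j : J | lfp f j != 0%E}.

Definition cleanup (J : finType) (f : polysys J) : polysys (cleaned_idx f) :=
  fun j => f (val j) \mPo
    [tuple if insub (enum_val i) is Some k then pvar (k : cleaned_idx f) else 0
    | i < #|J|].

Definition spectral_radius (n : nat) (A : 'M[R]_n) : R :=
  sup [set ComplexField.Normc.normc z
      | z in [set z : R[i] | eigenvalue (map_mx (real_complex R) A) z]].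

Lemma eeval_ge0 n (p : {mpoly R[n]}) (u : 'I_n -> \bar R) :
  (forall m, 0 <= p@_m) -> (forall i, 0 <= u i)%E -> (0 <= eeval u p)%E.
Proof.
move=> p_ge0 u_ge0; apply: sume_ge0 => m _; apply: mule_ge0.
  by rewrite lee_fin.
by apply: prode_ge0 => i _; exact: expe_ge0.
Qed.

Lemma eeval_mono n (p : {mpoly R[n]}) (u w : 'I_n -> \bar R) :
  (forall m, 0 <= p@_m) -> (forall i, 0 <= u i)%E ->
  (forall i, u i <= w i)%E -> (eeval u p <= eeval w p)%E.
Proof.
move=> p_ge0 u_ge0 le_uw; apply: lee_sum => m _.
suff /andP[? ?] : (0 <= \prod_(i < n) u i ^+ m i <=
    \prod_(i < n) w i ^+ m i)%E by apply: lee_pmul; rewrite ?lee_fin.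
elim/big_ind2: _ => [|x1 y1 x2 y2 /andP[? ?] /andP[? ?]|i _].
- by rewrite lee01 lexx.
- by rewrite mule_ge0 // lee_pmul.
rewrite expe_ge0 //=; elim: (m i) => [|k IHk]; first by rewrite !expe0.
by rewrite !expeS lee_pmul ?expe_ge0.
Qed.

Lemma lfpP (J : finType) (f : polysys J) : is_PPS f -> is_lfp f (lfp f).
Proof.
move=> f_ge0; apply: xgetPex.
pose F (u : J -> \bar R) j := eeval (u \o enum_val) (f j).
have Fmono u w : (forall j, 0 <= u j)%E -> (forall j, u j <= w j)%E ->
    forall j, (F u j <= F w j)%E.
  move=> u0 uw j; apply: eeval_mono => [m|i|i];
    by [exact: f_ge0|exact: u0|exact: uw].
have F_ge0 u : (forall j, 0 <= u j)%E -> forall j, (0 <= F u j)%E.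
  by move=> u0 j; apply: eeval_ge0 => [m|i]; [exact: f_ge0|exact: u0].
pose S := [set w : J -> \bar R | (forall j, 0 <= w j)%E /\
                                 forall j, (F w j <= w j)%E].
pose u j := ereal_inf [set w j | w in S].
have u_le w : S w -> forall j, (u j <= w j)%E.
  by move=> Sw j; apply: ereal_inf_lbound; exists w.
have u0 j : (0 <= u j)%E by apply: le_ereal_inf_tmp => _ [w [w0 _] <-].
have Fu j : (F u j <= u j)%E.
  apply: le_ereal_inf_tmp => _ [w Sw <-]; have [w0 Fw] := Sw.
  by apply: le_trans (Fw j); apply: Fmono => //; exact: u_le.
exists u; split; last first.
  by move=> w [w0 Fw]; apply: u_le; split=> // j; rewrite /F Fw.
split=> // j; apply/eqP; rewrite eq_le Fu /=.
by apply: (u_le (F u)); split=> [|k]; [exact: F_ge0|apply: Fmono => //; exact: F_ge0].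
Qed.

End PolynomialSystems.
Arguments cleanup {R J} f.
Arguments cleaned_idx {R J} f.

Definition fundamental (R : realType) (Q G : finType) (D : pPDA Q G) :
    polysys R (Q * G * Q)%type := fun j =>
  let: (p, Z, q) := j in
  (ratr (weight D p Z q [bseq]))%:MP
  + \sum_(r : Q) \sum_(Y : G)
      ratr (weight D p Z r [bseq Y]) *: pvar R (r, Y, q)
  + \sum_(r : Q) \sum_(Y : G) \sum_(X : G)
      ratr (weight D p Z r [bseq Y; X]) *:
        \sum_(t : Q) pvar R (r, Y, t) * pvar R (t, X, q).

Lemma fundamental_PPS (R : realType) (Q G : finType) (D : pPDA Q G) :
  is_PPS (fundamental R D).
Proof.
have w_ge0 p Z q alpha : ratr (weight D p Z q alpha) \in @Num.nneg R.
  rewrite nnegrE ler0q /weight; case E: (D p Z q alpha) => [a|] //=.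
  exact: trans_ge0 E.
move=> [[p Z] q] m; rewrite -nnegrE.
apply: (mpolyOverP _ _).
rewrite /fundamental rpredD ?rpredD ?mpolyOverC //; apply: rpred_sum => r _.
  by apply: rpred_sum => Y _; rewrite mpolyOverZ ?mpolyOverX.
apply: rpred_sum => Y _; apply: rpred_sum => X _; apply: mpolyOverZ => //.
by apply: rpred_sum => t _; apply: rpredM; rewrite mpolyOverX.
Qed.

Lemma cleanup_PPS (R : realType) (J : finType) (f : polysys R J) :
  is_PPS f -> is_PPS (cleanup f).
Proof.
move=> f_ge0 j m; rewrite -nnegrE; apply: (mpolyOverP _ _).
rewrite /cleanup comp_mpolyE; apply: rpred_sum => k _.
apply: mpolyOverZ; first exact: f_ge0.
apply: rpred_prod => i _; apply: rpredX; rewrite tnth_mktuple.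
by case: insub => [i'|]; rewrite ?mpolyOverX ?mpolyOver0.
Qed.

(* Main.v *)
(* First-step analysis shows that the return probabilities r = mu f are a fixed
   point of f, and that the first moments e satisfy e = r + f'(r) e: a run from
   pZ has one step more than the remaining run from the word that replaces Z,
   and runs from a word are concatenations of runs from its letters. Since
   r <= e <= C r, this gives f'(r) e = e - r <= (1 - 1/C) e, so that v is e
   divided by |e|_1 <= C |Q|^2 |G|. The bound on the spectral radius holds
   because a nonnegative matrix A with A v <= l v for some v > 0 has no
   eigenvalue of modulus larger than l. *)
Require Import Defs.
From HB Require Import structures.
From mathcomp Require Import all_boot all_order all_algebra.
From mathcomp Require Import complex.
(* The notations of mpoly and of normedtype clash. *)
From mathcomp Require Import -(notations) mpoly.
From mathcomp Require Import boolp classical_sets cardinality fsbigop.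
From mathcomp Require Import reals ereal normedtype sequences esum.
Set Implicit Arguments.
Unset Strict Implicit.
Unset Printing Implicit Defensive.
Import Order.TTheory GRing.Theory Num.Theory.
Local Open Scope ring_scope.

(** * Finite sums, short words and Cauchy products *)

Lemma esum_finType (R : realType) (T : finType) (P : pred T) (a : T -> \bar R) :
  (forall i, 0 <= a i)%E ->
  \esum_(i in [set i | P i]%classic) a i = (\sum_(i | P i) a i)%E.
Proof.
move=> a0; rewrite esum_fset //; last exact: finite_finset.
rewrite -big_enum /= [RHS]fsbig_seq ?enum_uniq //.
by apply: eq_fsbigl; apply/seteqP; split=> i /=; rewrite mem_enum.
Qed.

Lemma eqseq_cat2r (T : eqType) (s s1 s2 : seq T) :
  (s1 ++ s == s2 ++ s) = (s1 == s2).
Proof.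
apply/eqP/eqP => [eq_s|->//].
have /[!size_cat]/addIn sz : size (s1 ++ s) = size (s2 ++ s) by rewrite eq_s.
by move/eqP: eq_s; rewrite eqseq_cat // eqxx andbT => /eqP.
Qed.

(** Splitting by word length turns a sum over replacement words into the three groups of terms of
    the fundamental system. *)
Lemma big_bseq2 (T : finType) (V : nmodType) (F : 2.-bseq T -> V) :
  \sum_a F a =
  F [bseq] + \sum_Y F [bseq Y] + \sum_Y \sum_X F [bseq Y; X].
Proof.
pose e : seq (2.-bseq T) := [bseq] :: [seq [bseq Y] | Y <- enum T] ++
  [seq [bseq Y; X] | Y <- enum T, X <- enum T].
have e_uniq : uniq e.
  rewrite cons_uniq mem_cat negb_or -!andbA; apply/and3P; split.
  - by apply/negP => /mapP[Y _ /(congr1 val)].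
  - by apply/negP => /allpairsP[[Y X] [_ _ /(congr1 val)]].
  rewrite cat_uniq; apply/and3P; split.
  - by rewrite map_inj_uniq ?enum_uniq // => Y Y' /(congr1 val)[].
  - apply/hasPn => a /allpairsP[[Y X] [_ _ -> /=]].
    by apply/negP => /mapP[Y' _ /(congr1 val)].
  - by apply: allpairs_uniq; rewrite ?enum_uniq // => -[Y X] [Y' X'] _ _ /=
      /(congr1 val)[-> ->].
have e_all : index_enum _ =i e.
  move=> a; rewrite mem_index_enum; apply/esym.
  case: a => -[|Y [|X [|//]]] sz; rewrite inE mem_cat; apply/or3P.
  - by apply: Or31; apply/eqP/val_inj.
  - apply: Or32; apply/mapP; exists Y; rewrite ?mem_enum //; exact/val_inj.
  - apply: Or33; apply/allpairsP; exists (Y, X); rewrite !mem_enum.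
    by split=> //; exact/val_inj.
rewrite (perm_big e) /=; last exact: uniq_perm (index_enum_uniq _) _ e_all.
rewrite big_cons big_cat big_map big_allpairs_dep !big_enum addrA /=.
by congr (_ + _); apply: eq_bigr => Y _; rewrite big_enum.
Qed.

(** The convolution is a double series whose terms [c k n] vanish for [k > n]. Since all terms are
    nonnegative, the order of summation can be exchanged, and for fixed [k] the index [n] is shifted
    by [k]. *)
Lemma nneseries_cauchy_product (R : realType) (a b : nat -> R) (A B : R) :
  (forall n, 0 <= a n) -> (forall n, 0 <= b n) ->
  (\sum_(n <oo) (a n)%:E = A%:E)%E -> (\sum_(n <oo) (b n)%:E = B%:E)%E ->
  (\sum_(n <oo) (\sum_(k < n.+1) a k * b (n - k)%N)%R%:E = (A * B)%R%:E)%E.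
Proof.
move=> a0 b0 sa sb.
pose c k n : \bar R := ((k <= n)%N%:R * (a k * b (n - k)%N))%:E.
have c0 k n : (0 <= c k n)%E by rewrite lee_fin !mulr_ge0.
transitivity (\sum_(n <oo) \sum_(k <oo) c k n)%E.
  apply: eq_eseriesr => n _.
  rewrite (@nneseries_split _ (c^~ n) 0 n.+1) // add0n.
  rewrite [X in (_ + X)%E]eseries0 ?adde0; last first.
    by move=> k lt_nk _; rewrite /c leqNgt lt_nk mul0r.
  rewrite big_mkord -sumEFin; apply: eq_bigr => k _.
  by rewrite /c -ltnS ltn_ord mul1r.
rewrite nneseries_interchange //.
transitivity (\sum_(k <oo) (B%:E * (a k)%:E))%E; last first.
  by rewrite nneseriesZl ?sa 1?mulrC // => k _; rewrite lee_fin.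
apply: eq_eseriesr => k _.
rewrite (@nneseries_split _ (c k) 0 k) // add0n big1_seq ?add0e; last first.
  move=> n; rewrite mem_index_iota /c => /andP[_ /andP[_ lt_nk]].
  by rewrite leqNgt lt_nk mul0r.
rewrite -nneseries_addn // muleC -sb -nneseriesZl; last first.
  by move=> n _; rewrite lee_fin.
by apply: eq_eseriesr => n _; rewrite /c leq_addl addnK mul1r.
Qed.

(** * Stack words *)

Section WordExtension.
Context (S : nzRingType) (Q G : finType).
Implicit Types (p q t : Q) (Z : G) (s : seq G).

(* The return probabilities and the first moments of a stack word, computed
   from those of the single symbols: [word_ext] is a product of matrices over
   Q, and [word_dext] is its derivative in the direction [e]. *)
Fixpoint word_ext (u : Q * G * Q -> S) p s q : S :=
  if s is Z :: s' then \sum_t u (p, Z, t) * word_ext u t s' q else (p == q)%:R.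

Fixpoint word_dext (u e : Q * G * Q -> S) p s q : S :=
  if s is Z :: s' then
    \sum_t (e (p, Z, t) * word_ext u t s' q + u (p, Z, t) * word_dext u e t s' q)
  else 0.

Lemma word_ext_cat u p s1 s2 q :
  word_ext u p (s1 ++ s2) q = \sum_t word_ext u p s1 t * word_ext u t s2 q.
Proof.
elim: s1 p => [|Z s1 IHs] p /=.
  rewrite (bigD1 p) //= eqxx mul1r big1 ?addr0 // => t ne_tp.
  by rewrite eq_sym (negPf ne_tp) mul0r.
under [RHS]eq_bigr do rewrite mulr_suml.
rewrite exchange_big /=; apply: eq_bigr => t _.
by rewrite IHs mulr_sumr; apply: eq_bigr => t' _; rewrite mulrA.
Qed.

End WordExtension.

Lemma word_ext_ge0 (R : numDomainType) (Q G : finType) (u : Q * G * Q -> R)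
    p s q : (forall j, 0 <= u j) -> 0 <= word_ext u p s q.
Proof.
move=> u0; elim: s p => [|Z s IHs] p /=; first by rewrite ler0n.
by apply: sumr_ge0 => t _; rewrite mulr_ge0.
Qed.


Lemma word_dext_ge0 (R : numDomainType) (Q G : finType)
    (u e : Q * G * Q -> R) p s q :
  (forall j, 0 <= u j) -> (forall j, 0 <= e j) -> 0 <= word_dext u e p s q.
Proof.
move=> u0 e0; elim: s p => [|Z s IHs] p //=; apply: sumr_ge0 => t _.
by rewrite addr_ge0 ?mulr_ge0 ?word_ext_ge0.
Qed.

(** Evaluation and substitution of polynomials are ring morphisms, so this carries word formulas
    from variables to polynomials or values substituted for them. *)
Lemma word_ext_morph (S S' : nzRingType) (phi : {rmorphism S -> S'})
    (Q G : finType) (u : Q * G * Q -> S) p s q :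
  phi (word_ext u p s q) = word_ext (phi \o u) p s q.
Proof.
elim: s p => [|Z s IHs] p /=; first by rewrite rmorph_nat.
by rewrite rmorph_sum; apply: eq_bigr => t _; rewrite rmorphM IHs.
Qed.

Lemma word_ext_sym1 (S : nzRingType) (Q G : finType) (u : Q * G * Q -> S) p Z q :
  word_ext u p [:: Z] q = u (p, Z, q).
Proof.
rewrite /= (bigD1 q) //= eqxx mulr1 big1 ?addr0 // => t /negPf ne.
by rewrite ne mulr0.
Qed.

(** One sum over all replacement words lets later arguments avoid a case distinction on their
    length. *)
Lemma fundamentalE (R : realType) (Q G : finType) (D : pPDA Q G) p Z q :
  fundamental R D (p, Z, q) = \sum_r \sum_(alpha : 2.-bseq G)
    ratr (weight D p Z r alpha) *: word_ext (@pvar R _) r alpha q.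
Proof.
under [RHS]eq_bigr do rewrite big_bseq2.
rewrite !big_split /=; congr (_ + _ + _).
- rewrite (bigD1 q) //= eqxx big1 ?addr0 => [|r /negPf ne].
    by rewrite alg_mpolyC.
  by rewrite ne scaler0.
- apply: eq_bigr => r _; apply: eq_bigr => Y _.
  by rewrite -[\sum_t _]/(word_ext _ r [:: Y] q) word_ext_sym1.
apply: eq_bigr => r _; apply: eq_bigr => Y _; apply: eq_bigr => X _.
congr (_ *: _); apply: eq_bigr => t _.
by rewrite -[\sum_t _]/(word_ext _ t [:: X] q) word_ext_sym1.
Qed.

(** * Return probabilities and first moments *)

Section TerminationProbabilities.
Context (R : realType) (Q G : finType) (D : pPDA Q G).
Implicit Types (p q r t : Q) (Z : G) (s : seq G) (alpha : 2.-bseq G).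

Definition rweight p Z r alpha : R := ratr (weight D p Z r alpha).

Lemma rweight_ge0 p Z r alpha : 0 <= rweight p Z r alpha.
Proof.
rewrite ler0q /weight; case E: (D p Z r alpha) => [a|] //=.
exact: trans_ge0 E.
Qed.

Lemma rweight_sum1 p Z : \sum_r \sum_alpha rweight p Z r alpha = 1.
Proof.
rewrite -[RHS](rmorph1 (@ratr R)) -(trans_sum1 D p Z) rmorph_sum /=.
by apply: eq_bigr => r _; rewrite rmorph_sum.
Qed.

(** The total probability of the paths of exactly [n] steps from [p s] to [q] with empty stack, by
    recursion on the first step. An empty stack gives 0 for [n.+1] because it has no outgoing
    steps. *)
Fixpoint term_prob n p s q : R :=
  match n, s with
  | 0, _ => ((p == q) && (s == [::]))%:R
  | n.+1, [::] => 0
  | n.+1, Z :: s' =>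
      \sum_r \sum_alpha rweight p Z r alpha * term_prob n r (alpha ++ s') q
  end.

Lemma term_prob_ge0 n p s q : 0 <= term_prob n p s q.
Proof.
elim: n p s => [|n IHn] p [|Z s] //=.
apply: sumr_ge0 => r _; apply: sumr_ge0 => alpha _.
by rewrite mulr_ge0 ?rweight_ge0.
Qed.

Lemma term_prob_nil n p q : term_prob n p [::] q = ((n == 0%N) && (p == q))%:R.
Proof. by case: n => [|n] //=; rewrite andbT. Qed.

(** The word [s2] stays untouched until [s1] is used up; [t] and [k] are the state and the time at
    that moment. *)
Lemma term_prob_cat n p s1 s2 q :
  term_prob n p (s1 ++ s2) q =
  \sum_t \sum_(k < n.+1) term_prob k p s1 t * term_prob (n - k) t s2 q.
Proof.
elim: n p s1 => [|n IHn] p [|Z s1].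
- rewrite (bigD1 p) //= big_ord1 /= eqxx mul1r big1 ?addr0 // => t ne_tp.
  by rewrite big_ord1 /= eq_sym (negPf ne_tp) mul0r.
- by rewrite /= andbF big1 // => t _; rewrite big_ord1 /= andbF mul0r.
- rewrite cat0s (bigD1 p) //= [X in _ + X]big1 ?addr0 => [|t ne_tp].
    rewrite big_ord_recl big1 ?addr0 => [|k _].
      by rewrite term_prob_nil !eqxx mul1r subn0.
    by rewrite term_prob_nil mul0r.
  rewrite big1 // => k _.
  by rewrite term_prob_nil [p == t]eq_sym (negPf ne_tp) andbF mul0r.
rewrite /=; under eq_bigr => r _.
  under eq_bigr => alpha _ do rewrite catA IHn mulr_sumr.
  rewrite exchange_big /=; over.
rewrite exchange_big /=; apply: eq_bigr => t _.
(* The summand [k = 0] vanishes, since the nonempty word [Z :: s1] cannot be used up in no steps. *)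
rewrite big_ord_recl /= andbF mul0r add0r.
under [RHS]eq_bigr => k _.
  rewrite /bump /= add1n subSS mulr_suml.
  under eq_bigr => r _ do rewrite mulr_suml.
  over.
rewrite [RHS]exchange_big /=; apply: eq_bigr => r _.
rewrite [RHS]exchange_big /=; apply: eq_bigr => alpha _.
by rewrite mulr_sumr; apply: eq_bigr => k _; rewrite mulrA.
Qed.

(** * Paths of configurations, grouped by length *)

Definition runs_of_size n (c : config Q G) q : set (seq (config Q G)) :=
  [set s | [/\ path (step D) c s, last c s = (q, [::]) & size s = n]]%classic.

Lemma step_probE p Z s r alpha :
  step_prob D (p, Z :: s) (r, (alpha : seq G) ++ s) = weight D p Z r alpha.
Proof.
rewrite /step_prob /= (eq_bigl (pred1 alpha)) ?big_pred1_eq // => beta /=.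
by rewrite eq_sym eqseq_cat2r.
Qed.

Lemma path_prob_ge0 (c : config Q G) (x : seq (config Q G)) :
  0 <= path_prob D c x.
Proof.
elim: x c => [|c' x IHx] [p s] //=; apply: mulr_ge0 => //.
rewrite /step_prob; case: s => //= Z s; apply: sumr_ge0 => alpha _.
by have := rweight_ge0 p Z c'.1 alpha; rewrite ler0q.
Qed.

(** The factor [a] is the probability of the steps already taken, which the induction on the length
    accumulates. *)
Lemma esum_runs_of_size n (c : config Q G) q (a : R) : 0 <= a ->
  \esum_(x in runs_of_size n c q) (a * ratr (path_prob D c x))%:E =
  (a * term_prob n c.1 c.2 q)%:E.
Proof.
elim: n c a => [|n IHn] [p s] a a0.
  have [/andP[/eqP -> /eqP ->]|ne] := boolP ((p == q) && (s == [::])).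
    rewrite (_ : runs_of_size _ _ _ = [set [::]]%classic).
      by rewrite esum_set1 /= ?rmorph1 ?eqxx ?lee_fin ?mulr1.
    by apply/seteqP; split=> [x [_ _ /size0nil]|x ->].
  rewrite (_ : runs_of_size _ _ _ = set0) ?esum_set0 /= ?(negPf ne) ?mulr0 //.
  apply/seteqP; split=> // x [_ + /size0nil x0]; rewrite {}x0 /= => -[ep es].
  by rewrite ep es !eqxx in ne.
case: s => [|Z s].
  rewrite (_ : runs_of_size _ _ _ = set0) ?esum_set0 /= ?mulr0 //.
  by apply/seteqP; split=> // -[|c' x] [].
pose c : config Q G := (p, Z :: s).
(* A nonempty run is a pair of its first successor and the remaining run. *)
rewrite (@reindex_esum _ _ _
  ([set c' | step D c c'] `*`` (fun c' => runs_of_size n c' q))%classic _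
  (fun y => y.1 :: y.2)); last first.
  split.
  - by move=> [c' x] /= [cc' [px lx sx]]; split=> /=; rewrite ?cc' ?sx.
  - by move=> [c1 x1] [c2 x2] _ _ /= [-> ->].
  - move=> [|c' x] [] //= /andP[cc' px] lx [sx].
    by exists (c', x).
rewrite -(@esum_esum _ _ _ _ _ (fun c' x =>
  (a * ratr (path_prob D c (c' :: x)))%:E)); last first.
  by move=> c' x _ _; rewrite lee_fin mulr_ge0 // ler0q path_prob_ge0.
under eq_esum => c' cc'.
  under eq_esum => x _ do rewrite /= rmorphM mulrA.
  rewrite IHn; last first.
    have := path_prob_ge0 c [:: c']; rewrite /= mulr1 => ?.
    by rewrite mulr_ge0 ?ler0q.
  over.
(* The successors of [c] correspond one to one to the transitions from [p Z], so the sum over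
   configurations becomes finite. *)
rewrite (@reindex_esum _ _ _
  [set ra : Q * 2.-bseq G | D p Z ra.1 ra.2 != None]%classic _
  (fun ra => (ra.1, (ra.2 : seq G) ++ s))); last first.
  split.
  - by move=> [r al] /= nN; apply/existsP; exists al; rewrite nN eqxx.
  - move=> [r1 a1] [r2 a2] _ _ /= [-> /eqP].
    by rewrite eqseq_cat2r => /eqP/val_inj ->.
  - move=> [r s'] /= /existsP[al /andP[nN /eqP /= ->]].
    by exists (r, al).
rewrite (@esum_finType _ _ (fun ra => D p Z ra.1 ra.2 != None)); last first.
  move=> [r al] /=; rewrite step_probE lee_fin.
  by rewrite mulr_ge0 ?term_prob_ge0 // mulr_ge0 //; exact: rweight_ge0.
(* Pairs without a transition have weight 0, so the sum may range over all pairs. *)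
rewrite sumEFin /= pair_big [in LHS]big_mkcond /= mulr_sumr; congr _%:E.
apply: eq_bigr => -[r al] _ /=; rewrite step_probE mulrA /rweight /weight.
by case: (D p Z r al) => //=; rewrite rmorph0 mulr0 mul0r.
Qed.

(** The runs are the disjoint union of the runs of each length, and [h] is constant on each of
    these. Taking 1 or the identity for [h] yields the return probability or the first moment. *)
Lemma esum_runs (j : Q * G * Q) (h : nat -> R) : (forall n, 0 <= h n) ->
  \esum_(x in runs D j) (ratr (path_prob D (start j) x) * h (size x))%:E =
  (\sum_(n <oo) (h n * term_prob n j.1.1 [:: j.1.2] j.2)%:E)%E.
Proof.
move=> h0.
rewrite (_ : runs D j = \bigcup_n runs_of_size n (start j) j.2)%classic.
  rewrite nneseries_sum_bigcup.
  - apply: eq_eseriesr => n _; rewrite -(esum_runs_of_size n (start j)) //.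
    by apply: eq_esum => x [_ _ ->]; rewrite mulrC.
  - by move=> m n _ _ [x [[_ _ <-] [_ _ <-]]].
  - by move=> x; rewrite lee_fin mulr_ge0 // ler0q path_prob_ge0.
apply/seteqP; split=> [x [px lx]|x [n _ [px lx _]]]; last by [].
by exists (size x).
Qed.

(** * Series over path lengths, and first-step equations *)

Definition pathsum (h : nat -> R) p s q : \bar R :=
  (\sum_(n <oo) (h n * term_prob n p s q)%:E)%E.

Lemma pathsum_ge0 h p s q : (forall n, 0 <= h n) -> (0 <= pathsum h p s q)%E.
Proof.
by move=> h0; apply: nneseries_ge0 => n _ _; rewrite lee_fin mulr_ge0 ?term_prob_ge0.
Qed.

Lemma pathsum_nil h p q : (forall n, 0 <= h n) ->
  pathsum h p [::] q = (h 0%N * (p == q)%:R)%:E.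
Proof.
move=> h0; rewrite /pathsum nneseries_recl // => [|n _]; last first.
  by rewrite lee_fin mulr_ge0 ?term_prob_ge0.
rewrite eseries0 ?adde0 ?term_prob_nil // => -[//|n _ _].
by rewrite term_prob_nil mulr0.
Qed.

(** First-step analysis: the shift of [h] accounts for the step taken, and length 0 contributes
    nothing because the stack is nonempty. *)
Lemma pathsum_cons h p Z s q : (forall n, 0 <= h n) ->
  pathsum h p (Z :: s) q =
  (\sum_r \sum_alpha (rweight p Z r alpha)%:E *
     pathsum (fun n => h n.+1) r (alpha ++ s) q)%E.
Proof.
move=> h0; have hP0 (k : nat -> R) n p' s' : (forall n, 0 <= k n) ->
    (0 <= (k n * term_prob n p' s' q)%:E)%E.
  by move=> k0; rewrite lee_fin mulr_ge0 ?term_prob_ge0.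
rewrite /pathsum nneseries_recl // => [|n _]; last exact: hP0.
rewrite /= andbF mulr0 add0e -nneseries_addn => [|n]; last exact: hP0.
under [RHS]eq_bigr => r _.
  under eq_bigr => alpha _.
    rewrite -nneseriesZl => [|n _]; last exact: (hP0 (fun n => h n.+1)).
    over.
  rewrite -nneseries_sum => [|alpha n _]; last first.
    by rewrite mule_ge0 ?(hP0 (fun n => h n.+1)) ?lee_fin ?rweight_ge0.
  over.
rewrite -nneseries_sum => [|r n _]; last first.
  apply: sume_ge0 => alpha _.
  by rewrite mule_ge0 ?(hP0 (fun n => h n.+1)) ?lee_fin ?rweight_ge0.
apply: eq_eseriesr => n _; rewrite addn1 /= mulr_sumr -sumEFin.
apply: eq_bigr => r _; rewrite mulr_sumr -sumEFin; apply: eq_bigr => alpha _.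
by rewrite -EFinM mulrCA.
Qed.

(** As in Kleene iteration from 0, the probability of termination in fewer than [N] steps stays
    below every nonnegative fixed point, by induction on [N]. *)
Lemma sum_term_prob_le N u p s q : (forall j, 0 <= u j) ->
  (forall p Z q,
    u (p, Z, q) = \sum_r \sum_alpha rweight p Z r alpha * word_ext u r alpha q) ->
  \sum_(n < N) term_prob n p s q <= word_ext u p s q.
Proof.
move=> u0 ufix; elim: N p s => [|N IHN] p [|Z s].
- by rewrite big_ord0 ler0n.
- by rewrite big_ord0 word_ext_ge0.
- rewrite (eq_bigr (fun n => ((val n == 0%N) && (p == q))%:R)) => [|n _].
    by rewrite big_ord_recl big1 ?addr0.
  by rewrite term_prob_nil.
rewrite big_ord_recl /= andbF add0r exchange_big /=.
(* The fixed point equation expands the first letter; [word_ext_cat] then joins [alpha] and [s] into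
   the word of the induction hypothesis. *)
under [leRHS]eq_bigr => t _.
  rewrite ufix mulr_suml; under eq_bigr do rewrite mulr_suml.
  over.
rewrite [leRHS]exchange_big /=; apply: ler_sum => r _.
rewrite exchange_big [leRHS]exchange_big /=; apply: ler_sum => alpha _.
rewrite -mulr_sumr.
under [leRHS]eq_bigr do rewrite -mulrA.
rewrite -mulr_sumr -word_ext_cat.
by apply: ler_wpM2l; rewrite ?rweight_ge0.
Qed.

(** Termination at different times or in different states are disjoint events, and the weights out
    of [p Z] add up to 1. This makes the return series finite without reference to a fixed point. *)
Lemma sum_term_prob_le1 N p s : \sum_q \sum_(n < N) term_prob n p s q <= 1.
Proof.
elim: N p s => [|N IHN] p s.
  by under eq_bigr do rewrite big_ord0; rewrite big1.
case: s => [|Z s].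
  rewrite (bigD1 p) //= [X in _ + X]big1 ?addr0 => [|t ne_tp].
    by rewrite big_ord_recl big1 ?addr0 /= ?eqxx // => n _; rewrite term_prob_nil.
  rewrite big1 // => n _.
  by rewrite term_prob_nil [p == t]eq_sym (negPf ne_tp) andbF.
under eq_bigr => q _.
  rewrite big_ord_recl /= andbF add0r exchange_big /=.
  under eq_bigr => r _ do rewrite exchange_big /=.
  over.
rewrite exchange_big /= -(rweight_sum1 p Z); apply: ler_sum => r _.
rewrite exchange_big /=; apply: ler_sum => alpha _.
under eq_bigr => q _ do rewrite -mulr_sumr.
by rewrite -mulr_sumr ler_piMr ?rweight_ge0.
Qed.

Lemma pathsum1_le p s q (x : R) :
  (forall N, \sum_(n < N) term_prob n p s q <= x) ->
  (pathsum (fun=> 1%R) p s q <= x%:E)%E.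
Proof.
move=> lex; apply: lime_le.
  by apply: is_cvg_nneseries => n _ _; rewrite lee_fin mul1r term_prob_ge0.
apply: nearW => N /=; rewrite sumEFin lee_fin big_mkord.
by under eq_bigr do rewrite mul1r.
Qed.

Lemma pathsum1_le1 p s q : (pathsum (fun=> 1%R) p s q <= 1)%E.
Proof.
apply: pathsum1_le => N; apply: le_trans (sum_term_prob_le1 N p s).
rewrite (bigD1 q) //= lerDl; apply: sumr_ge0 => t _.
by apply: sumr_ge0 => n _; exact: term_prob_ge0.
Qed.

Lemma pathsum1_fin p s q : pathsum (fun=> 1) p s q \is a fin_num.
Proof.
by rewrite ge0_fin_numE ?pathsum_ge0 // (le_lt_trans (pathsum1_le1 p s q)) ?ltry.
Qed.

Definition rret (j : Q * G * Q) : R :=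
  fine (pathsum (fun=> 1) j.1.1 [:: j.1.2] j.2).

(** Since [fine] maps an infinite moment to 0, this is the first moment only where that is finite,
    which [cPAST_moment_fin] supplies. *)
Definition rmom (j : Q * G * Q) : R :=
  fine (pathsum (fun n => n%:R) j.1.1 [:: j.1.2] j.2).

(** A run from [Z :: s] is a run from [Z] followed by one from [s]. Lengths are thus convolved, and
    the Cauchy product turns the convolution into a product. *)
Lemma pathsum1_word p s q : pathsum (fun=> 1) p s q = (word_ext rret p s q)%:E.
Proof.
elim: s p => [|Z s IHs] p; first by rewrite pathsum_nil // mul1r.
rewrite /pathsum /= -sumEFin.
under [RHS]eq_bigr => t _.
  rewrite -(nneseries_cauchy_product (a := fun n => term_prob n p [:: Z] t)
   (b := fun n => term_prob n t s q)); first last.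
  - rewrite -IHs; apply: eq_eseriesr => n _; first by rewrite mul1r.
  - rewrite /rret /= fineK ?pathsum1_fin //.
    by apply: eq_eseriesr => n _; rewrite mul1r.
  - by move=> n; exact: term_prob_ge0.
  - by move=> n; exact: term_prob_ge0.
  over.
rewrite -nneseries_sum => [|t n _]; last first.
  by rewrite lee_fin sumr_ge0 // => k _; rewrite mulr_ge0 ?term_prob_ge0.
apply: eq_eseriesr => n _.
by rewrite mul1r -cat1s term_prob_cat -sumEFin.
Qed.

(** Lengths add under concatenation, so the moment obeys the product rule that defines
    [word_dext]. *)
Lemma pathsum_mom_word p s q :
  (forall p Z q, pathsum (fun n => n%:R) p [:: Z] q \is a fin_num) ->
  pathsum (fun n => n%:R) p s q = (word_dext rret rmom p s q)%:E.
Proof.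
move=> mom_fin; elim: s p => [|Z s IHs] p; first by rewrite pathsum_nil // mul0r.
pose a t n := term_prob n p [:: Z] t.
pose b t n := term_prob n t s q.
have a0 t n : 0 <= a t n by exact: term_prob_ge0.
have b0 t n : 0 <= b t n by exact: term_prob_ge0.
have sa t : (\sum_(n <oo) (a t n)%:E = (rret (p, Z, t))%:E)%E.
  rewrite /rret /= fineK ?pathsum1_fin //.
  by apply: eq_eseriesr => n _; rewrite mul1r.
have sb t : (\sum_(n <oo) (b t n)%:E = (word_ext rret t s q)%:E)%E.
  by rewrite -pathsum1_word; apply: eq_eseriesr => n _; rewrite mul1r.
have sna t : (\sum_(n <oo) (n%:R * a t n)%:E = (rmom (p, Z, t))%:E)%E.
  by rewrite /rmom /= fineK.
have snb t : (\sum_(n <oo) (n%:R * b t n)%:E = (word_dext rret rmom t s q)%:E)%E.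
  by rewrite -IHs.
have conv0 (c d : nat -> R) n : (forall n, 0 <= c n) -> (forall n, 0 <= d n) ->
    (0 <= (\sum_(k < n.+1) c k * d (n - k)%N)%:E)%E.
  by move=> c0 d0; rewrite lee_fin sumr_ge0 // => k _; rewrite mulr_ge0.
have na0 t n : 0 <= n%:R * a t n by rewrite mulr_ge0.
have nb0 t n : 0 <= n%:R * b t n by rewrite mulr_ge0.
rewrite /pathsum /= -sumEFin.
under [RHS]eq_bigr => t _.
  rewrite EFinD -(nneseries_cauchy_product _ _ (sna t) (sb t)) //.
  rewrite -(nneseries_cauchy_product _ _ (sa t) (snb t)) //.
  rewrite -nneseriesD => [|n _ _|n _ _].
  - over.
  - exact: (conv0 (fun n => n%:R * a t n) (b t)).
  - exact: (conv0 (a t) (fun n => n%:R * b t n)).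
rewrite -nneseries_sum => [|t n _]; last first.
  apply: adde_ge0; first exact: (conv0 (fun n => n%:R * a t n) (b t)).
  exact: (conv0 (a t) (fun n => n%:R * b t n)).
apply: eq_eseriesr => n _.
under [RHS]eq_bigr do rewrite -EFinD.
rewrite -cat1s term_prob_cat [RHS]sumEFin mulr_sumr; congr _%:E.
apply: eq_bigr => t _; rewrite -big_split mulr_sumr; apply: eq_bigr => k _ /=.
(* The total length [n] is distributed as [k + (n - k)] over the two factors. *)
rewrite -mulrA [X in _ = _ + X]mulrCA -mulrDl -natrD subnKC //.
by rewrite -ltnS.
Qed.

Lemma rret_fixpoint p Z q :
  rret (p, Z, q) =
  \sum_r \sum_alpha rweight p Z r alpha * word_ext rret r alpha q.
Proof.
apply: EFin_inj; rewrite /rret /= fineK ?pathsum1_fin // pathsum_cons //.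
rewrite -sumEFin; apply: eq_bigr => r _; rewrite -sumEFin.
by apply: eq_bigr => alpha _; rewrite cats0 pathsum1_word.
Qed.

(** After the first step the weight [n.+1] splits into [n] and 1; the part with 1 adds up to the
    return probability by [rret_fixpoint]. *)
Lemma rmom_eq p Z q :
  (forall p Z q, pathsum (fun n => n%:R) p [:: Z] q \is a fin_num) ->
  rmom (p, Z, q) = rret (p, Z, q) +
    \sum_r \sum_alpha rweight p Z r alpha * word_dext rret rmom r alpha q.
Proof.
move=> mom_fin; apply: EFin_inj; rewrite rret_fixpoint -big_split /=.
rewrite [in LHS]/rmom /= fineK // pathsum_cons //.
rewrite -sumEFin; apply: eq_bigr => r _; rewrite -big_split -sumEFin /=.
apply: eq_bigr => alpha _; rewrite cats0 -mulrDr [RHS]EFinM EFinD; congr (_ * _)%E.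
rewrite -pathsum1_word -pathsum_mom_word // -nneseriesD.
- by apply: eq_eseriesr => n _; rewrite -EFinD -mulrDl nat1r.
- by move=> n _ _; rewrite lee_fin mulr_ge0 ?term_prob_ge0.
- by move=> n _ _; rewrite lee_fin mulr_ge0 ?term_prob_ge0.
Qed.

Lemma rret_le (u : Q * G * Q -> R) : (forall j, 0 <= u j) ->
  (forall p Z q,
    u (p, Z, q) = \sum_r \sum_alpha rweight p Z r alpha * word_ext u r alpha q) ->
  forall j, rret j <= u j.
Proof.
move=> u0 ufix [[p Z] q]; rewrite -lee_fin fineK ?pathsum1_fin //.
apply: pathsum1_le => N; apply: le_trans (sum_term_prob_le N _ _ _ u0 ufix) _.
rewrite /= (bigD1 q) //= eqxx mulr1 big1 ?addr0 // => t /negPf ne.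
by rewrite ne mulr0.
Qed.

Lemma rret_ge0 j : 0 <= rret j.
Proof. by rewrite fine_ge0 ?pathsum_ge0. Qed.

Lemma rret_le1 j : rret j <= 1.
Proof. by rewrite -lee_fin fineK ?pathsum1_fin // pathsum1_le1. Qed.

Lemma rmom_ge0 j : 0 <= rmom j.
Proof. by rewrite fine_ge0 ?pathsum_ge0. Qed.

Lemma retE j : ret D R j = (rret j)%:E.
Proof.
rewrite /rret fineK ?pathsum1_fin // /ret /pathsum.
rewrite -(esum_runs j (h := fun=> 1)) //.
by apply: eq_esum => x _; rewrite mulr1.
Qed.

Lemma momentE j :
  moment D R j = pathsum (fun n => n%:R) j.1.1 [:: j.1.2] j.2.
Proof. by rewrite /moment (esum_runs j (h := fun n => n%:R)). Qed.

(** A vanishing series of nonnegative terms has only zero terms. This covers the triples on which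
    [cPAST] imposes no condition. *)
Lemma rret_eq0_moment j : rret j = 0 -> moment D R j = 0%E.
Proof.
move=> r0; rewrite momentE /pathsum eseries0 // => n _ _.
suff -> : term_prob n j.1.1 [:: j.1.2] j.2 = 0 by rewrite mulr0.
apply/eqP; rewrite eq_le term_prob_ge0 andbT -lee_fin -r0 fineK ?pathsum1_fin //.
have P0 k : (0 <= (1 * term_prob k j.1.1 [:: j.1.2] j.2)%:E)%E.
  by rewrite mul1r lee_fin term_prob_ge0.
(* The term of index [n] is at most the partial sum of the first [n.+1] terms, hence at most the
   total. *)
apply: le_trans (nneseries_lim_ge n.+1 (fun k _ _ => P0 k)).
by rewrite big_nat_recr //= mul1r leeDr // sume_ge0.
Qed.

Lemma cPAST_moment_fin : cPAST D R ->
  forall p Z q, pathsum (fun n => n%:R) p [:: Z] q \is a fin_num.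
Proof.
move=> past p Z q; rewrite -[pathsum _ _ _ _](momentE (p, Z, q)).
have [r0|r_gt0] := leP (rret (p, Z, q)) 0.
  by rewrite rret_eq0_moment //; apply/eqP; rewrite eq_le r0 rret_ge0.
have := past (p, Z, q); rewrite /cond_runtime retE lte_fin => /(_ r_gt0).
rewrite inver gt_eqF // lte_pdivrMr // => mom_lt.
rewrite ge0_fin_numE ?momentE ?pathsum_ge0 // -momentE.
by rewrite (lt_le_trans mom_lt) ?leey.
Qed.

End TerminationProbabilities.

(** * Least fixed points and Jacobi matrices *)

Lemma eeval_EFin (R : realType) n (u : 'I_n -> R) (p : mpoly n R) :
  eeval (fun i => (u i)%:E) p = (meval u p)%:E.
Proof.
rewrite /eeval mevalE -sumEFin; apply: eq_bigr => m _; rewrite EFinM.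
congr (_ * _)%E; rewrite -prodEFin; apply: eq_bigr => i _.
by rewrite EFin_expe.
Qed.

(** * Directional derivatives of polynomials *)

Section DirectionalDerivative.
Context (R : realType) (n : nat) (u e : 'I_n -> R).

(** This is an entry of a Jacobi matrix at [u] applied to the vector [e]. Being linear with a
    product rule, it can be computed on words without expanding partial derivatives. *)
Definition dirderiv (p : mpoly n R) : R := \sum_i meval u (mderiv i p) * e i.

Fact dirderiv_linear : linear_for *%R dirderiv.
Proof.
move=> c p q; rewrite /dirderiv mulr_sumr -big_split; apply: eq_bigr => i _ /=.
by rewrite mderivD mderivZ mevalD mevalZ mulrDl mulrA.
Qed.

HB.instance Definition _ :=
  GRing.isLinear.Build R (mpoly n R) R *%R dirderiv dirderiv_linear.

Lemma dirderivM p q :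
  dirderiv (p * q) = dirderiv p * meval u q + meval u p * dirderiv q.
Proof.
rewrite /dirderiv mulr_suml mulr_sumr -big_split; apply: eq_bigr => i _ /=.
by rewrite mderivM mevalD !mevalM mulrDl mulrAC mulrA.
Qed.

Lemma dirderivC c : dirderiv (mpolyC n c) = 0.
Proof. by rewrite /dirderiv big1 // => i _; rewrite mderivC meval0 mul0r. Qed.

Lemma dirderivX i : dirderiv (mpolyX R (mnm1 i)) = e i.
Proof.
rewrite /dirderiv (bigD1 i) //= big1 ?addr0 => [|k ne_ki].
  rewrite mderivX mnm1E eqxx mevalZ -[X in mnm_sub X _]add0m addmK.
  by rewrite mpolyX0 meval1 !mul1r.
by rewrite mderivX mnm1E eq_sym (negPf ne_ki) scale0r meval0 mul0r.
Qed.

Lemma dirderiv_word (Q G : finType) (x : Q * G * Q -> mpoly n R) p s q :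
  dirderiv (word_ext x p s q) =
  word_dext (meval u \o x) (dirderiv \o x) p s q.
Proof.
elim: s p => [|Z s IHs] p /=.
  by rewrite -mpolyC_nat dirderivC.
rewrite raddf_sum; apply: eq_bigr => t _ /=.
by rewrite dirderivM IHs word_ext_morph.
Qed.

End DirectionalDerivative.

(** * The cleaned-up system and its least fixed point *)

Section CleanedFundamental.
Context (R : realType) (Q G : finType) (D : pPDA Q G).
Notation f := (fundamental R D).
Notation J := (cleaned_idx f).

(** Extension by 0 mirrors on values what [cleanup] does to the deleted variables. *)
Definition zero_ext (w : J -> R) (j : Q * G * Q) : R :=
  if insub j is Some k then w k else 0.

Definition clean_var (j : Q * G * Q) : mpoly #|J| R :=
  if insub j is Some k then pvar R (k : J) else 0.

Lemma cleanupE (k : J) p Z q : val k = (p, Z, q) ->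
  cleanup f k = \sum_r \sum_alpha
    rweight R D p Z r alpha *: word_ext clean_var r (alpha : 2.-bseq G) q.
Proof.
move=> kE; rewrite /cleanup kE fundamentalE raddf_sum; apply: eq_bigr => r _.
rewrite raddf_sum; apply: eq_bigr => alpha _ /=.
rewrite linearZ /= word_ext_morph; congr (_ *: word_ext _ _ _ _).
apply/funext => j /=; rewrite /pvar comp_mpolyXU -tnth_nth tnth_mktuple.
by rewrite enum_rankK.
Qed.

Lemma meval_clean_var (w : J -> R) j :
  meval (w \o enum_val) (clean_var j) = zero_ext w j.
Proof.
rewrite /clean_var /zero_ext; case: insubP => [k _ _|_]; last by rewrite meval0.
by rewrite mevalXU /= enum_rankK.
Qed.

Lemma dirderiv_clean_var (w e : J -> R) j :
  dirderiv (w \o enum_val) (e \o enum_val) (clean_var j) = zero_ext e j.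
Proof.
rewrite /clean_var /zero_ext; case: insubP => [k _ _|_]; last by rewrite raddf0.
by rewrite dirderivX /= enum_rankK.
Qed.

Lemma meval_fundamental (u : Q * G * Q -> R) p Z q :
  meval (u \o enum_val) (f (p, Z, q)) =
  \sum_r \sum_alpha rweight R D p Z r alpha * word_ext u r (alpha : 2.-bseq G) q.
Proof.
rewrite fundamentalE raddf_sum; apply: eq_bigr => r _.
rewrite raddf_sum; apply: eq_bigr => alpha _ /=.
rewrite mevalZ word_ext_morph; congr (_ * word_ext _ _ _ _).
by apply/funext => j /=; rewrite mevalXU /= enum_rankK.
Qed.

Lemma meval_cleanup (w : J -> R) (k : J) :
  meval (w \o enum_val) (cleanup f k) =
  meval (zero_ext w \o enum_val) (f (val k)).
Proof.
case kE: (val k) => [[p Z] q]; rewrite (cleanupE kE) meval_fundamental.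
rewrite raddf_sum; apply: eq_bigr => r _.
rewrite raddf_sum; apply: eq_bigr => alpha _ /=.
rewrite mevalZ word_ext_morph; congr (_ * word_ext _ _ _ _).
by apply/funext => j /=; rewrite meval_clean_var.
Qed.

Lemma dirderiv_cleanup (w e : J -> R) (k : J) p Z q : val k = (p, Z, q) ->
  dirderiv (w \o enum_val) (e \o enum_val) (cleanup f k) =
  \sum_r \sum_alpha rweight R D p Z r alpha *
    word_dext (zero_ext w) (zero_ext e) r (alpha : 2.-bseq G) q.
Proof.
move=> kE; rewrite (cleanupE kE) raddf_sum; apply: eq_bigr => r _.
rewrite raddf_sum; apply: eq_bigr => alpha _ /=.
rewrite linearZ /= dirderiv_word; congr (_ * word_dext _ _ _ _ _).
  by apply/funext => j /=; rewrite meval_clean_var.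
by apply/funext => j /=; rewrite dirderiv_clean_var.
Qed.

Lemma is_fixpoint_EFin (K : finType) (h : polysys R K) (u : K -> R) :
  is_fixpoint h (fun j => (u j)%:E) <->
  (forall j, 0 <= u j) /\ forall j, meval (u \o enum_val) (h j) = u j.
Proof.
split=> -[u0 ufix]; split=> j.
- by have := u0 j; rewrite lee_fin.
- by apply: EFin_inj; rewrite -eeval_EFin -[RHS]ufix.
- by rewrite lee_fin.
- by rewrite -[in RHS]ufix -eeval_EFin.
Qed.

(** The least fixed point lies below the real fixed point [u] and is therefore finite, so it
    suffices to compare [u] with real fixed points below it. *)
Lemma lfp_EFin (K : finType) (h : polysys R K) (u : K -> R) :
  (forall j, 0 <= u j) -> (forall j, meval (u \o enum_val) (h j) = u j) ->
  is_PPS h ->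
  (forall w : K -> R, (forall j, 0 <= w j) -> (forall j, w j <= u j) ->
    (forall j, meval (w \o enum_val) (h j) = w j) -> forall j, u j <= w j) ->
  lfp h = fun j => (u j)%:E.
Proof.
move=> u0 ufix hPPS umin; have [[l0 lfix] lle] := lfpP hPPS.
have le_lu : forall j, (lfp h j <= (u j)%:E)%E.
  by apply: lle; apply/is_fixpoint_EFin.
have lE j : lfp h j = (fine (lfp h j))%:E.
  by rewrite fineK // ge0_fin_numE // (le_lt_trans (le_lu j)) ?ltry.
have [w0 wfix] : (forall j, 0 <= fine (lfp h j)) /\
    forall j, meval ((fun j => fine (lfp h j)) \o enum_val) (h j) = fine (lfp h j).
  by apply/is_fixpoint_EFin; rewrite -(funext lE).
apply/funext => j; apply/eqP; rewrite eq_le le_lu /= lE lee_fin.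
by apply: (umin (fun i => fine (lfp h i))) => // i; rewrite -lee_fin -lE.
Qed.

Lemma lfp_fundamental : lfp f = fun j => (rret R D j)%:E.
Proof.
apply: lfp_EFin => [j|[[p Z] q]||w w0 _ wfix].
- exact: rret_ge0.
- by rewrite meval_fundamental -rret_fixpoint.
- exact: fundamental_PPS.
by apply: rret_le => // p Z q; rewrite -meval_fundamental wfix.
Qed.

Lemma zero_ext_restrict (u : Q * G * Q -> R) j :
  (rret R D j = 0 -> u j = 0) -> zero_ext (u \o val) j = u j.
Proof.
rewrite /zero_ext; case: insubP => [k _ <- //|].
by rewrite negbK lfp_fundamental => /eqP[->] ->.
Qed.

Lemma lfp_cleanup : lfp (cleanup f) = fun k => (rret R D (val k))%:E.
Proof.
have extE : zero_ext (rret R D \o val) = rret R D.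
  by apply/funext => j; exact: zero_ext_restrict.
apply: lfp_EFin => [k|k||w w0 wle wfix k].
- exact: rret_ge0.
- rewrite (meval_cleanup (rret R D \o val)) extE; case: (val k) => [[p Z] q].
  by rewrite meval_fundamental -rret_fixpoint.
- exact/cleanup_PPS/fundamental_PPS.
have ext0 j : 0 <= zero_ext w j by rewrite /zero_ext; case: insub.
have extle j : zero_ext w j <= rret R D j.
  by rewrite /zero_ext; case: insubP => [i _ <-|_]; rewrite ?rret_ge0.
suff : rret R D (val k) <= zero_ext w (val k) by rewrite /zero_ext valK.
apply: rret_le => // p Z q; rewrite -meval_fundamental.
rewrite {1}/zero_ext; case: insubP => [i _ iE|].
  by rewrite -wfix meval_cleanup iE.
(* At a deleted index, monotonicity bounds the value of [f] at the extended [w] by its value at the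
   return probabilities, which is 0. So the extension is a fixed point of [f] there too. *)
rewrite negbK lfp_fundamental => /eqP[r0]; apply/esym/eqP.
have f0 := @fundamental_PPS R _ _ D (p, Z, q).
rewrite eq_le -!lee_fin -!eeval_EFin; apply/andP; split; last first.
  by apply: eeval_ge0 => // i; rewrite lee_fin ext0.
rewrite -r0 rret_fixpoint -meval_fundamental -eeval_EFin.
by apply: eeval_mono => // i; rewrite lee_fin ?ext0 ?extle.
Qed.

End CleanedFundamental.

Lemma jacobi_ge0 (R : realType) (J : finType) (f : polysys R J) (u : J -> R) i k :
  is_PPS f -> (forall j, 0 <= u j) -> 0 <= jacobi f u i k.
Proof.
move=> f0 u0; rewrite mxE mevalE; apply: sumr_ge0 => m _; apply: mulr_ge0.
  by rewrite mcoeff_deriv mulrn_wge0.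
by apply: prodr_ge0 => l _; rewrite exprn_ge0 /=.
Qed.

(** * A Perron-Frobenius type bound on the spectral radius *)

Import ComplexField.Normc.

(** For a left eigenvector [w] with eigenvalue [z], the moduli [N] satisfy [|z| N <= N A] by the
    triangle inequality. Pairing with [v] gives [|z| N v <= N A v <= l N v], and [N v > 0]
    cancels. *)
Lemma spectral_radius_le (R : realType) n (A : 'M[R]_n) (v : 'cV[R]_n) (l : R) :
  0 <= l -> (forall i k, 0 <= A i k) -> (forall i, 0 < v i 0) ->
  (forall i, (A *m v) i 0 <= l * v i 0) -> spectral_radius A <= l.
Proof.
move=> l0 A0 v0 Av; rewrite /spectral_radius.
(* The supremum of the empty set is 0, which [0 <= l] covers. *)
set S := (X in sup X); have [->|/set0P S0] := eqVneq S set0; first by rewrite sup0.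
apply: ge_sup => // _ [z /eigenvalueP[w wA w_neq0] <-].
pose N k := normc (w 0 k).
have N0 k : 0 <= N k by rewrite /N; case: (w 0 k) => a b; rewrite sqrtr_ge0.
have le_zN k : normc z * N k <= \sum_i N i * A i k.
  have -> : normc z * N k = normc (\sum_i w 0 i * (A i k)%:C%C).
    rewrite -normcM; congr normc.
    have /matrixP/(_ 0 k) := wA; rewrite !mxE => <-.
    by apply: eq_bigr => i _; rewrite !mxE.
  rewrite (eq_bigr (fun i => normc (w 0 i * (A i k)%:C%C))) => [|i _].
    elim/big_ind2: _ => // [|x1 x2 y1 y2 le1 le2]; first by rewrite normc0.
    by apply: le_trans (le_normcD _ _) _; rewrite lerD.
  by rewrite normcM /= [X in _ + X]expr0n addr0 sqrtr_sqr ger0_norm.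
(* The pairing of the moduli with [v] is positive because [w] is nonzero and [v] is positive
   everywhere. *)
pose T := \sum_k N k * v k 0.
have T_gt0 : 0 < T.
  have [k wk] : exists k, w 0 k != 0.
    by apply/existsP; apply: contraR w_neq0 => /existsPn w0;
      apply/eqP/rowP => k; rewrite mxE; apply/eqP; rewrite -[_ == _]negbK w0.
  rewrite /T (bigD1 k) //= ltr_pwDl ?sumr_ge0 // => [|i _].
    rewrite mulr_gt0 // lt_def N0 andbT; apply: contra_neq wk; exact: eq0_normc.
  by rewrite mulr_ge0 // ltW.
rewrite -(ler_pM2r T_gt0) /T !mulr_sumr.
apply: (@le_trans _ _ (\sum_k (\sum_i N i * A i k) * v k 0)).
  by apply: ler_sum => k _; rewrite mulrA ler_wpM2r // ltW.
under eq_bigr => k _ do rewrite mulr_suml.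
rewrite exchange_big /=; apply: ler_sum => i _.
under eq_bigr => k _ do rewrite -mulrA.
rewrite -mulr_sumr mulrCA ler_wpM2l //.
by have := Av i; rewrite mxE.
Qed.

(** * The eigenvector bound *)

Section RuntimeBounds.
Context (R : realType) (Q G : finType) (D : pPDA Q G) (hD : cPAST D R).
Notation r := (rret R D).
Notation e := (rmom R D).

Lemma rmom_eq_past p Z q :
  e (p, Z, q) = r (p, Z, q) +
    \sum_t \sum_alpha rweight R D p Z t alpha *
      word_dext r e t (alpha : 2.-bseq G) q.
Proof. by apply: rmom_eq; exact: cPAST_moment_fin. Qed.

(** By the first-step equation the difference is a sum of nonnegative terms: every run counted here
    has at least one step. *)
Lemma rret_le_rmom j : r j <= e j.
Proof.
case: j => [[p Z] q]; rewrite rmom_eq_past lerDl.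
apply: sumr_ge0 => t _; apply: sumr_ge0 => alpha _.
rewrite mulr_ge0 ?rweight_ge0 ?word_dext_ge0 // => j.
  exact: rret_ge0.
exact: rmom_ge0.
Qed.

Lemma cond_runtimeE j : 0 < r j -> cond_runtime D R j = (e j / r j)%:E.
Proof.
move=> r_gt0; rewrite /cond_runtime retE momentE.
rewrite inver gt_eqF // EFinM /rmom fineK //.
by case: j r_gt0 => [[p Z] q] _; exact: cPAST_moment_fin.
Qed.

Lemma le_max_runtime j : 0 < r j -> e j / r j <= max_runtime D R.
Proof.
move=> r_gt0; rewrite -lee_fin -cond_runtimeE // /max_runtime.
have rj : (0 < ret D R j)%E by rewrite retE lte_fin.
have le_j : (cond_runtime D R j <= \big[Order.max/-oo]_(i | 0 < ret D R i)
    cond_runtime D R i)%E by exact: le_bigmax_cond.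
(* The maximum must be finite for [fine] to keep it: the index [j] excludes [-oo], and [cPAST]
   excludes [+oo]. *)
rewrite fineK // fin_numE -ltNye -ltey; apply/andP; split.
  by apply: lt_le_trans le_j; rewrite cond_runtimeE // ltNyr.
by apply: bigmax_lt => // i /hD.
Qed.

Lemma min_ret_le j : 0 < r j -> min_ret D R <= r j.
Proof.
move=> r_gt0; rewrite -lee_fin -retE /min_ret.
have rj : (0 < ret D R j)%E by rewrite retE lte_fin.
have le_j : (\big[Order.min/+oo]_(i | 0 < ret D R i) ret D R i <= ret D R j)%E.
  exact: bigmin_le_cond.
rewrite fineK // ge0_fin_numE; last by apply: le_bigmin => // i /ltW.
by apply: le_lt_trans le_j _; rewrite retE ltry.
Qed.

Lemma min_ret_ge0 : 0 <= min_ret D R.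
Proof. by apply: fine_ge0; apply: le_bigmin => // i /ltW. Qed.

End RuntimeBounds.

Theorem lemma10 (R : realType) (Q G : finType) (D : pPDA Q G)
    (hne : exists j : Q * G * Q, (0 < ret D R j)%E)
    (hD : cPAST D R) :
  let f := fundamental R D in
  let g := cleanup f in
  let A := jacobi g (fun j => fine (lfp g j)) in
  let C := max_runtime D R in
  let m := min_ret D R in
  [/\ 1 <= C,
      (exists v : 'cV[R]_#|cleaned_idx f|,
        [/\ forall i, 0 < v i 0,
            \sum_i `|v i 0| = 1,
            forall i, (A *m v) i 0 <= ((1 - C^-1) *: v) i 0
          & forall i, m / (C * #|Q|%:R ^+ 2 * #|G|%:R) <= v i 0])
    & spectral_radius A <= 1 - C^-1].
Proof.
move=> f g A C m; pose J := cleaned_idx f.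
have [j0 r_j0] : exists j, 0 < rret R D j.
  by case: hne => j; rewrite retE lte_fin; exists j.
have C_ge1 : 1 <= C.
  apply: le_trans (le_max_runtime hD r_j0).
  by rewrite ler_pdivlMr // mul1r rret_le_rmom.
have C_gt0 : 0 < C by exact: lt_le_trans C_ge1.
pose w (k : J) := rret R D (val k); pose e (k : J) := rmom R D (val k).
have lfpE j : lfp f j = (rret R D j)%:E by rewrite /f lfp_fundamental.
have w_gt0 k : 0 < w k.
  rewrite lt_def rret_ge0 andbT; have := valP k.
  by rewrite (lfpE (val k)) eqe.
have le_we k : w k <= e k by exact: rret_le_rmom.
have e_gt0 k : 0 < e k by exact: lt_le_trans (le_we k).
have le_eC k : e k <= C * w k.
  by rewrite -ler_pdivrMr //; exact: (le_max_runtime hD (w_gt0 k)).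
have AE : A = jacobi g w.
  by congr jacobi; apply/funext => k; rewrite /g lfp_cleanup.
(* The triple [j0] survives the clean-up, so the index set is nonempty and the normalising sum [S]
   is positive. *)
have k0P : lfp f j0 != 0%E by rewrite lfpE eqe gt_eqF.
pose k0 : J := Sub j0 k0P.
pose S := \sum_(k : J) e k.
have S_gt0 : 0 < S.
  rewrite /S (bigD1 k0) //= ltr_pwDl ?sumr_ge0 // => k _; exact: ltW.
(* Each summand is at most [C] times a return probability, hence at most [C], and there are at most
   [|Q|^2 |G|] indices. *)
have S_le : S <= C * #|Q|%:R ^+ 2 * #|G|%:R.
  apply: (@le_trans _ _ (\sum_(k : J) C)).
    apply: ler_sum => k _; apply: le_trans (le_eC k) _.
    by rewrite ler_piMr ?rret_le1 // ltW.
  rewrite sumr_const -[leLHS]mulr_natr -[leRHS]mulrA -natrX -natrM.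
  apply: ler_wpM2l; rewrite ?ler_nat 1?ltW //.
  apply: leq_trans (max_card _) _ => /=.
  rewrite card_sub; apply: leq_trans (max_card _) _.
  by rewrite !card_prod mulnAC mulnn leqnn.
pose v : 'cV[R]_#|J| := \col_i (e (enum_val i) / S).
have v_gt0 i : 0 < v i 0 by rewrite mxE divr_gt0.
have Av i : (A *m v) i 0 <= (1 - C^-1) * v i 0.
  have -> : (A *m v) i 0 = dirderiv (w \o enum_val) (e \o enum_val)
      (g (enum_val i)) / S.
    rewrite AE mxE /dirderiv mulr_suml; apply: eq_bigr => k _.
    by rewrite !mxE mulrA.
  rewrite [v i 0]mxE mulrA ler_pM2r ?invr_gt0 //.
  case kE: (val (enum_val i)) => [[p Z] q].
  have -> : dirderiv (w \o enum_val) (e \o enum_val) (g (enum_val i)) =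
      e (enum_val i) - w (enum_val i).
    rewrite (dirderiv_cleanup _ _ kE) /e /w kE (rmom_eq_past hD) addrC addKr.
    apply: eq_bigr => t _; apply: eq_bigr => alpha _.
    congr (_ * word_dext _ _ _ _ _); apply/funext => j.
      by apply: (zero_ext_restrict (u := rret R D)).
    (* Deleted triples have return probability 0 and hence moment 0, so extending the restricted
       moments by 0 recovers all moments. *)
    apply: (zero_ext_restrict (u := rmom R D)) => /rret_eq0_moment.
    by rewrite momentE /rmom => ->.
  (* The inequality [e - w <= (1 - C^-1) e] amounts to [e <= C w]. *)
  by rewrite mulrBl mul1r lerD2l lerN2 ler_pdivrMl // le_eC.
have A_ge0 i k : 0 <= A i k.
  rewrite AE; apply: jacobi_ge0; first exact/cleanup_PPS/fundamental_PPS.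
  by move=> j; exact: ltW.
split=> //; last first.
  apply: spectral_radius_le A_ge0 v_gt0 Av.
  by rewrite subr_ge0 invf_le1.
exists v; split=> // [|i|i]; last 1 first.
(* The numerator is bounded by [m <= w <= e] and the denominator by [S_le]. *)
- rewrite mxE; apply: ler_pM; rewrite ?min_ret_ge0 //.
  + by rewrite invr_ge0 (le_trans (ltW S_gt0)).
  + by apply: le_trans (le_we _); apply: min_ret_le; exact: w_gt0.
  + by rewrite lef_pV2 ?posrE // (lt_le_trans S_gt0).
- under eq_bigr => i _ do rewrite gtr0_norm // mxE.
  rewrite -mulr_suml (_ : \sum_i _ = S) ?divff ?gt_eqF //.
  by rewrite /S (reindex (@enum_val J predT)) //=; exact/onW_bij/enum_val_bij.
by rewrite [leRHS]mxE; exact: Av.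
Qed.
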